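(* Let $e\in\mathscr{E}$ and let $T^e:\mathbb{X}\to\mathbb{X}$ be the map of the unit cylinder $\mathbb{X}=\mathbb{S}^1\times\mathbb{R}$ given by $$T^e(\theta,\rho)=(\theta+\kappa\rho,\,\rho),\qquad \kappa=\kappa(e)=-\tfrac12\,(2\lfloor\sqrt{e/2}\rfloor+1)^2\,\mathcal{T}'(e).$$ Then for all sufficiently small $\lambda>0$ the change of coordinates $\eta^e_\lambda:\mathscr{X}^e\to\mathbb{X}$ semi-intertwines the first-return map of $\mathscr{F}_\lambda$ to $\mathscr{X}^e$ with $T^e$, that is, the corresponding square diagram commutes: $$\eta^e_\lambda\big(\mathscr{F}_\lambda^{\,t(z)}(z)\big)=T^e\big(\eta^e_\lambda(z)\big)\qquad\text{for all } z\in\mathscr{X}^e,$$ where $t(z)$ is the first-return time of $z$ to $\mathscr{X}^e$ under $\mathscr{F}_\lambda$.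
   Context: Hamiltonian and flow. Let $P(x)=\lfloor x\rfloor^2+(2\lfloor x\rfloor+1)\{x\}$ for $x\in\mathbb{R}$, with $\{x\}=x-\lfloor x\rfloor$, and let $H:\mathbb{R}^2\to\mathbb{R}$, $H(x,y)=P(x)+P(y)$. Off the lines $x\in\mathbb{Z}$, $y\in\mathbb{Z}$ its Hamiltonian vector field is $\mathbf{w}(x,y)=(2\lfloor y\rfloor+1,\,-(2\lfloor x\rfloor+1))$. For $m\in\mathbb{Z}$, $\mathbf{w}_{m,m}=(2m+1,-(2m+1))$ is the value of $\mathbf{w}$ on the box $(m,m)+[0,1)^2$. For $\alpha>0$ the level set $\Pi(\alpha)=\{z\in\mathbb{R}^2 : H(z)=\alpha\}$ is a closed convex polygon; the flow moves along it with velocity $\mathbf{w}$ on each edge, continuing continuously through the vertices. $\varphi_t$ denotes the time-$t$ advance map of this flow (the origin is fixed and plays no role). Period function. $\mathcal{T}(\alpha)$ is the period of the flow on $\Pi(\alpha)$; explicitly $$\frac{\mathcal{T}(\alpha)}{8}=\frac{P^{-1}(\alpha/2)}{2\lfloor\sqrt{\alpha/2}\rfloor+1}-2\sum_{n=\lfloor\sqrt{\alpha/2}\rfloor+1}^{\lfloor\sqrt{\alpha}\rfloor}\frac{P^{-1}(\alpha-n^2)}{4n^2-1},\qquad P^{-1}(x)=\frac{x+\lfloor\sqrt{x}\rfloor(1+\lfloor\sqrt{x}\rfloor)}{2\lfloor\sqrt{x}\rfloor+1}\ (x\ge 0),$$ with an empty sum equal to $0$. One writes $\mathcal{T}(z)=\mathcal{T}(H(z))$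 for $z\in\mathbb{R}^2$. Critical numbers. $\mathscr{E}=\{e_i : i\ge 0\}=\{0,1,2,4,5,8,9,\dots\}$ is the increasing enumeration of the non-negative integers that are sums of two integer squares, and $\mathscr{I}^{e_i}=(e_i,e_{i+1})$. The derivative of $\mathcal{T}$ is constant on each $\mathscr{I}^e$, and $\mathcal{T}'(e)$ denotes this constant value. The map and the section. For $\lambda>0$ define $\mathscr{F}_\lambda(z)=\varphi_{(\lambda-\mathcal{T}(z))/4}(z)$, and let $$\mathscr{X}=\{\varphi_{\lambda\theta}(x,x) : x\ge 0,\ \theta\in[-1/2,1/2)\}.$$ Let $e\in\mathscr{E}$ and $m=\lfloor\sqrt{e/2}\rfloor$. A point $z\in\mathscr{X}$ with $H(z)\in\mathscr{I}^e$ is called regular if $\varphi_\lambda(z)=z+\lambda\mathbf{w}(z)=z+\lambda\mathbf{w}_{m,m}$. Set $$\mathscr{X}^e=\{z\in\mathscr{X} : H(z)\in I^e(\lambda)\},$$ where $I^e(\lambda)\subset\mathscr{I}^e$ is the largest interval such that all points of $\mathscr{X}^e$ are regular. The first-return time $t(z)$ of $z\in\mathscr{X}^e$ is the least integer $k\geq 1$ with $\mathscr{F}_\lambda^k(z)\in\mathscr{X}^e$. Change of coordinates. $\mathbb{S}^1=\mathbb{R}/\mathbb{Z}$ is identified with the interval $[-1/2,1/2)$. The map $\eta^e_\lambda:\mathscr{X}^e\to\mathbb{X}$, $z=(x,y)\mapsto(\theta,\rho)$, is given by $$\theta(z)=\frac1\lambda\,\frac{x-y}{2(2\lfloor\sqrt{e/2}\rfloor+1)},\qquad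 \rho(z)=\frac1\lambda\,\frac{x+y-2x_0}{2(2\lfloor\sqrt{e/2}\rfloor+1)},$$ where $z_0=(x_0,x_0)\in\mathscr{X}^e$ is some fixed point, on the line $x=y$, of the first-return map $z\mapsto\mathscr{F}_\lambda^{t(z)}(z)$; such a fixed point exists for all sufficiently small $\lambda$ (any choice may be used). *)

(* Defs.v *)
From HB Require Import structures.
From mathcomp Require Import all_boot all_order all_algebra.
From mathcomp Require Import all_classical all_reals all_analysis.
From mathcomp Require Import lra.

Set Implicit Arguments.
Unset Strict Implicit.
Unset Printing Implicit Defensive.
Import Order.TTheory GRing.Theory Num.Theory.
Import numFieldNormedType.Exports.
Local Open Scope classical_set_scope.
Local Open Scope ring_scope.

Section Hamiltonian.
Variable R : realType.
Implicit Types (x y : R) (z : R * R).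

Definition fracpart x : R := x - (Num.floor x)%:~R.

Definition Pfun x : R :=
  (Num.floor x)%:~R ^+ 2 + (2 * (Num.floor x)%:~R + 1) * fracpart x.

Definition Ham z : R := Pfun z.1 + Pfun z.2.

(* The field is given on the lattice lines too, by the same floor formula;
   the flow only uses its values off the lines. *)
Definition wfield z : R * R :=
  (2 * (Num.floor z.2)%:~R + 1, - (2 * (Num.floor z.1)%:~R + 1)).

Definition wbox (m : int) : R * R := (2 * m%:~R + 1, - (2 * m%:~R + 1)).

Definition off_lines z : Prop :=
  (z.1 \isn't a Num.int) /\ (z.2 \isn't a Num.int).

(* Away from the origin, an orbit stays on its polygon, is continuous in time,
   and has velocity w off the lattice lines, i.e. on the open edges. The points
   of a polygon on the lattice lines are its vertices (w has no zero component,
   and changes direction across every line); asking that they are met at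
   isolated times excludes curves that rest at a vertex, where no velocity is
   prescribed. *)
Definition is_flow (phi : R -> R * R -> R * R) : Prop :=
  [/\ forall z, phi 0 z = z,
      forall s t z, phi (s + t) z = phi s (phi t z),
      forall t, phi t (0, 0) = (0, 0) &
      forall z, z <> (0, 0) ->
      [/\ forall t, Ham (phi t z) = Ham z,
          continuous (fun t => phi t z),
          forall t : R, \forall s \near t^', off_lines (phi s z) &
          forall t : R, off_lines (phi t z) ->
            is_derive t 1 (fun s => (phi s z).1) (wfield (phi t z)).1 /\
            is_derive t 1 (fun s => (phi s z).2) (wfield (phi t z)).2]].

End Hamiltonian.

Definition crit : set nat :=
  [set n | exists a b : int, n%:Z = a ^+ 2 + b ^+ 2].

Definition next_crit (e e' : nat) : Prop :=
  [/\ crit e', (e < e')%N & forall n, crit n -> (e < n)%N -> (e' <= n)%N].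

Section ReturnMap.
Variable R : realType.
Implicit Types (z : R * R) (lambda alpha : R) (e : nat).

Definition crit_itv e : set R :=
  [set alpha | exists2 e', next_crit e e' & e%:R < alpha < e'%:R].

Definition diag_box e : int := Num.floor (Num.sqrt (e%:R / 2 : R)).

Variable phi : R -> R * R -> R * R.

(* The infimum is the least period when alpha > 0; it is 0 when alpha = 0. *)
Definition Tperiod alpha : R :=
  inf [set t | 0 < t /\ forall z, Ham z = alpha -> phi t z = z].

(* Well defined since the derivative is constant on the (non-empty) interval. *)
Definition dTperiod e : R :=
  get [set d : R | forall alpha, crit_itv e alpha ->
                     is_derive alpha 1 Tperiod d].

Definition Fmap lambda z : R * R := phi ((lambda - Tperiod (Ham z)) / 4) z.

Definition Xsection lambda : set (R * R) :=
  [set z | exists x theta : R,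
    [/\ 0 <= x, - (1 / 2) <= theta < 1 / 2 &
        z = phi (lambda * theta) (x, x)]].

Definition regular_point e lambda z : Prop :=
  phi lambda z = z + lambda *: wfield z /\
  z + lambda *: wfield z = z + lambda *: wbox R (diag_box e).

Definition regular_interval e lambda (J : set R) : Prop :=
  [/\ is_interval J, J `<=` crit_itv e &
      forall z, Xsection lambda z -> J (Ham z) -> regular_point e lambda z].

(* The largest J satisfying regular_interval; it is the union of them all. *)
Definition regular_range e lambda : set R :=
  \bigcup_(J in regular_interval e lambda) J.

Definition Xe e lambda : set (R * R) :=
  [set z | Xsection lambda z /\ regular_range e lambda (Ham z)].

Definition first_return e lambda z (k : nat) : Prop :=
  [/\ (0 < k)%N, Xe e lambda (iter k (Fmap lambda) z) &
      forall j : nat, (0 < j < k)%N ->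
        ~ Xe e lambda (iter j (Fmap lambda) z)].

Definition return_fixed e lambda z : Prop :=
  exists2 k, first_return e lambda z k & iter k (Fmap lambda) z = z.

End ReturnMap.

Section Cylinder.
Variable R : realType.

(* R/Z, represented by [-1/2, 1/2); toS1 is the projection R -> R/Z. *)
Definition S1 : Type := {theta : R | - (1 / 2) <= theta < 1 / 2}.

Fact toS1_subproof (x : R) :
  - (1 / 2) <= x - (Num.floor (x + 1 / 2))%:~R < 1 / 2.
Proof.
have := floor_itv (x + 1 / 2); rewrite intrD => /andP[h1 h2].
by apply/andP; split; lra.
Qed.

Definition toS1 (x : R) : S1 :=
  exist (fun theta : R => is_true (- (1 / 2) <= theta < 1 / 2)) _
    (toS1_subproof x).

Definition cylinder : Type := (S1 * R)%type.

Definition twist (kappa : R) (p : cylinder) : cylinder :=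
  (toS1 (sval p.1 + kappa * p.2), p.2).

Definition eta_coord (e : nat) (lambda x0 : R) (z : R * R) : cylinder :=
  let c := 2 * (2 * (diag_box R e)%:~R + 1) in
  (toS1 (1 / lambda * ((z.1 - z.2) / c)),
   1 / lambda * ((z.1 + z.2 - 2 * x0) / c)).

Definition shear (phi : R -> R * R -> R * R) (e : nat) : R :=
  - (1 / 2) * (2 * (diag_box R e)%:~R + 1) ^+ 2 * dTperiod phi e.

End Cylinder.

(* Main.v *)
From HB Require Import structures.
From mathcomp Require Import all_boot all_order all_algebra.
From mathcomp Require Import all_classical all_reals all_analysis.
From mathcomp Require Import zify ring lra.
Require Import Defs.
Import Order.TTheory GRing.Theory Num.Theory.
Import numFieldNormedType.Exports.
Local Open Scope classical_set_scope.
Local Open Scope ring_scope.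

(** Why the theorem holds.

    In the first quadrant [u = P(x)] moves from 0 to alpha on the level set
    [P(x) + P(y) = alpha], and [du/dt = P'(x) P'(y)]. With g = 1 / P' read as a
    step function of P, the time spent in the quadrant is the convolution
    (g * g)(alpha). The function g jumps exactly at the squares, say by c_n at
    n^2, so the quarter period is the sum over n and k of
    c_n c_k max(0, alpha - n^2 - k^2) ([quarter_time]). This is affine in alpha
    as long as alpha avoids the sums of two squares, which is why the period
    has a constant derivative on each critical interval ([Tperiod_affine]).

    A flow is only given by its velocity off the lattice lines. A continuous
    function whose derivative is known off isolated points is still controlled
    by it ([ndecr_off_isolated]); applied to the clock [arc_clock] along an
    orbit, this shows that the orbit runs through the first quadrant in time
    [quarter_time] ([quarter_arc]). Conjugating by the quarter turn gives
    another flow of the same kind, hence the other three quadrants: each level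
    set is a single periodic orbit, of period four times the quarter time
    ([periodic_level]).

    On a level set the map F is then the rotation by (lambda - T)/4 of a circle
    of length T, and the section is an arc of length lambda centred at the
    diagonal. If the section arc is regular then it is a straight segment in the
    diagonal box ([Xe_straight]), so that it does not overlap itself and
    lambda <= T. Every fourth iterate advances by lambda, and the first return
    comes from the arc that is one quarter turn away: the return map is
    theta |-> theta + (1 - T/lambda)/4 modulo 1 ([first_return_rotation],
    [return_map]). At the fixed point (1 - T/lambda)/4 is an integer, so on other
    levels the shift is -(T(alpha) - T(alpha_0))/(4 lambda) modulo 1. As T is
    affine, and alpha is affine in x + y on the box, this is kappa rho. *)

(** * The convex function P *)

Lemma PfunE {R : realType} (x : R) :
  Pfun x = (2 * (Num.floor x)%:~R + 1) * x
           - (Num.floor x)%:~R * ((Num.floor x)%:~R + 1).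
Proof. rewrite /Pfun /fracpart; ring. Qed.

Lemma floor_bounds {R : realType} (x : R) :
  (Num.floor x)%:~R <= x < (Num.floor x)%:~R + 1.
Proof. by have := floor_itv x; rewrite intrD. Qed.

(** P is convex, with right derivative [2 * floor x + 1]: this one inequality
    yields monotonicity, the growth of P and its continuity. *)
Lemma Pfun_subgradient {R : realType} (x y : R) :
  Pfun x + (2 * (Num.floor x)%:~R + 1) * (y - x) <= Pfun y.
Proof.
rewrite !PfunE.
have /andP[h1 h2] := floor_bounds x; have /andP[h3 h4] := floor_bounds y.
set n := Num.floor x in h1 h2 *; set m := Num.floor y in h3 h4 *.
have [le_nm|lt_mn] := lerP n m.
  have : (n%:~R : R) <= m%:~R by rewrite ler_int.
  have [->|] := eqVneq n m; first by lra.
  move=> ne; have : (n + 1)%:~R <= m%:~R :> R by rewrite ler_int; lia.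
  rewrite intrD => *; nra.
have : (m + 1)%:~R <= n%:~R :> R by rewrite ler_int; lia.
rewrite intrD => *; nra.
Qed.

Lemma floor_opp_notint {R : realType} (x : R) : x \isn't a Num.int ->
  Num.floor (- x) = - Num.floor x - 1.
Proof.
move=> xN; apply: floor_def; rewrite subrK intrB intrN.
have /andP[h1 h2] := floor_bounds x.
have h : (Num.floor x)%:~R != x by apply: contra xN => /eqP <-; exact: intr_int.
rewrite lerNr opprB opprK [_ < _]ltrN2 lt_neqAle h h1 andbT; lra.
Qed.

Lemma slope_opp {R : realType} (x : R) : x \isn't a Num.int ->
  2 * (Num.floor (- x))%:~R + 1 = - (2 * (Num.floor x)%:~R + 1) :> R.
Proof. by move=> /floor_opp_notint->; rewrite intrB intrN; ring. Qed.

Lemma Pfun_opp {R : realType} (x : R) : Pfun (- x) = Pfun x.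
Proof.
have [/intrP[n ->]|xN] := boolP (x \is a Num.int).
  rewrite -intrN !PfunE !intrKfloor intrN; ring.
rewrite !PfunE (slope_opp x xN) (floor_opp_notint x xN) intrB intrN; ring.
Qed.

Lemma Pfun0 {R : realType} : Pfun (0 : R) = 0.
Proof. by rewrite PfunE floor0; ring. Qed.

Lemma Pfun_int {R : realType} (n : int) : Pfun (n%:~R : R) = n%:~R ^+ 2.
Proof. by rewrite PfunE intrKfloor; ring. Qed.

Lemma Pfun_lt {R : realType} (x y : R) : 0 <= x -> x < y -> Pfun x < Pfun y.
Proof.
move=> x0 xy; have := Pfun_subgradient x y.
have : 0 <= (Num.floor x)%:~R :> R by rewrite ler0z floor_ge0.
nra.
Qed.

Lemma Pfun_inj {R : realType} (x y : R) :
  0 <= x -> 0 <= y -> Pfun x = Pfun y -> x = y.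
Proof.
move=> x0 y0 E; have [/(Pfun_lt x y x0)|/(Pfun_lt y x y0)|//] := ltgtP x y;
by rewrite E ltxx.
Qed.

Lemma Pfun_ge {R : realType} (x : R) : x <= Pfun x.
Proof. have := Pfun_subgradient 0 x; rewrite Pfun0 floor0; lra. Qed.

Lemma Pfun_ge0 {R : realType} (x : R) : 0 <= Pfun x.
Proof. have := Pfun_ge x; have := Pfun_ge (- x); rewrite Pfun_opp; lra. Qed.

Lemma Pfun_continuous {R : realType} : continuous (@Pfun R).
Proof.
move=> x; apply/cvgrPdist_le => e e0.
pose C : R := 2 * `|x| + 5.
have C0 : 0 < C by rewrite /C; have := normr_ge0 x; lra.
near=> y.
have yx1 : `|x - y| <= 1.
  near: y; apply: (@cvgr_dist_le _ _ _ (nbhs x) _ id x) => //.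
have yxe : `|x - y| <= e / C.
  near: y; apply: (@cvgr_dist_le _ _ _ (nbhs x) _ id x) => //;
    exact: divr_gt0.
have slope (u v : R) : `|u| <= `|x| + 1 -> Pfun u - Pfun v <= C * `|u - v|.
  move=> ux; have := Pfun_subgradient u v.
  have /andP[h1 h2] := floor_bounds u.
  have := ler_norm u; have := ler_norm (- u); rewrite normrN => h3 h4.
  set w := 2 * _ + 1.
  have Cw : `|w| <= C by rewrite ler_norml /w /C; apply/andP; split; lra.
  have h5 : w * (u - v) <= C * `|u - v|.
    apply: le_trans (ler_norm _) _; rewrite normrM; exact: ler_wpM2r.
  lra.
have yn : `|y| <= `|x| + 1.
  have := lerB_dist x y; have := lerB_dist y x; rewrite distrC; lra.
have h1 : Pfun x - Pfun y <= C * `|x - y| by apply: slope; lra.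
have h2 : Pfun y - Pfun x <= C * `|x - y| by rewrite distrC; exact: slope.
have h3 : C * `|x - y| <= e by rewrite mulrC -ler_pdivlMr.
rewrite ler_norml; apply/andP; split; lra.
Unshelve. all: by end_near.
Qed.

Lemma near_floor {R : realType} (x : R) : x \isn't a Num.int ->
  \forall y \near x, Num.floor y = Num.floor x.
Proof.
move=> xN; have /andP[h1 h2] := floor_bounds x.
have h : (Num.floor x)%:~R < x.
  rewrite lt_neqAle h1 andbT; apply: contra xN => /eqP <-; exact: intr_int.
near=> y; apply: floor_def; rewrite intrD; apply/andP; split.
  apply: ltW; near: y; exact: lt_nbhsr.
near: y; exact: lt_nbhsl.
Unshelve. all: by end_near.
Qed.

Lemma is_derive_Pfun {R : realType} (x : R) : x \isn't a Num.int ->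
  is_derive x 1 (@Pfun R) (2 * (Num.floor x)%:~R + 1).
Proof.
move=> xN.
pose a : R := 2 * (Num.floor x)%:~R + 1.
pose b : R := (Num.floor x)%:~R * ((Num.floor x)%:~R + 1).
have : is_derive x (1 : R) (fun y : R => a * y - b) a.
  by apply: is_derive_eq; rewrite subr0 [LHS]mulr1.
apply: near_eq_is_derive.
near=> y; rewrite PfunE.
have -> // : Num.floor y = Num.floor x.
near: y; exact: near_floor.
Unshelve. all: by end_near.
Qed.

(** * Functions with a derivative off isolated points *)

(** [G] is a set of good times which contains a punctured neighbourhood of every
    point, so near each point the mean value theorem applies on either side; a
    supremum argument makes the local comparison global. *)
Lemma ndecr_off_isolated {R : realType} (f : R -> R) (G : set R) (a b : R) :
  a <= b -> continuous f -> (forall t : R, \forall s \near t^', G s) ->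
  (forall s, a < s < b -> G s -> exists2 d, 0 <= d & is_derive s 1 f d) ->
  f a <= f b.
Proof.
move=> ab fc nG df.
have piece u v : a <= u -> u <= v -> v <= b ->
    (forall s, u < s < v -> G s) -> f u <= f v.
  move=> au uv vb uvG.
  have dE s : s \in `]u, v[%R -> exists2 d, 0 <= d & is_derive s 1 f d.
    rewrite in_itv/= => /andP[us sv]; apply: df; last by apply: uvG; rewrite us.
    by rewrite (le_lt_trans au us) (lt_le_trans sv vb).
  apply: (@ger0_derive1_le_cc _ f u v) => //.
  - by move=> s /dE[d _ []].
  - by move=> s /dE[d d0 [_ E]]; rewrite derive1E E.
  - exact: continuous_subspaceT.
  - by rewrite in_itv/= lexx.
  - by rewrite in_itv/= lexx andbT.
pose S := [set t | a <= t <= b /\ f a <= f t].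
have Sa : S a by split; rewrite ?lexx.
have Sub : ubound S b by move=> t [/andP[]].
have hS : has_sup S by split; [exists a|exists b].
set c := sup S.
have ac : a <= c by apply: ub_le_sup; first exact: (proj2 hS).
have cb : c <= b by apply: ge_sup; first exact: (proj1 hS).
have [e /= e0 eG] := (nbhs_ballP _ _).1 (nG c).
have {}eG s : `|c - s| < e -> s != c -> G s by move=> h; apply: eG.
have fac : f a <= f c.
  have [t St ct] := sup_adherent e0 hS.
  have tc : t <= c by apply: ub_le_sup; first exact: (proj2 hS).
  have [/andP[at_ tb] fat] := St.
  apply: (le_trans fat); apply: piece => // s /andP[ts sc].
  apply: eG; last by rewrite lt_eqF.
  rewrite ger0_norm; rewrite -/c in ct; lra.
have [cltb|bc] := ltP c b; last by have <- : c = b by apply/le_anti/andP.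
pose v := Num.min b (c + e / 2).
have cv : c < v by rewrite lt_min cltb /=; lra.
have vc : v <= c + e / 2 by rewrite ge_min lexx orbT.
have vb : v <= b by rewrite ge_min lexx.
have Sv : S v.
  split; first by rewrite vb andbT (le_trans ac (ltW cv)).
  apply: (le_trans fac); apply: piece => //; first exact: ltW.
  move=> s /andP[cs sv]; apply: eG; last by rewrite gt_eqF.
  rewrite ler0_norm; lra.
suff : v <= c by rewrite leNgt cv.
by apply: ub_le_sup; first exact: (proj2 hS).
Qed.

Lemma slope_off_isolated {R : realType} (f : R -> R) (G : set R) (c a b : R) :
  a <= b -> continuous f -> (forall t : R, \forall s \near t^', G s) ->
  (forall s, a < s < b -> G s -> is_derive s 1 f c) ->
  f b - f a = c * (b - a).
Proof.
move=> ab fc nG df.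
have cc (k : R) : continuous (fun t : R => k * t).
  by move=> t; apply: cvgM; [exact: cvg_cst|exact: cvg_id].
have h1 : f a - c * a <= f b - c * b.
  apply: (@ndecr_off_isolated _ (fun t => f t - c * t) G) => //.
    by move=> t; apply: cvgB; [exact: fc|exact: cc].
  move=> s sab Gs; exists 0 => //; have d := df s sab Gs.
  by apply: is_derive_eq; rewrite [_ *: _]mulr1 subrr.
have h2 : c * a - f a <= c * b - f b.
  apply: (@ndecr_off_isolated _ (fun t => c * t - f t) G) => //.
    by move=> t; apply: cvgB; [exact: cc|exact: fc].
  move=> s sab Gs; exists 0 => //; have d := df s sab Gs.
  by apply: is_derive_eq; rewrite [_ *: _]mulr1 subrr.
lra.
Qed.

Lemma first_nonpos {R : realType} (f : R -> R) (b : R) :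
  continuous f -> 0 < f 0 -> 0 <= b -> f b <= 0 ->
  exists c, [/\ 0 < c <= b, f c = 0 & forall s, 0 <= s < c -> 0 < f s].
Proof.
move=> fc f0 b0 fb.
pose S := [set t | 0 <= t <= b /\ f t <= 0].
have Sb : S b by split; rewrite ?lexx ?b0.
have hS : has_inf S by split; [exists b|exists 0 => t [/andP[]]].
set c := inf S.
have c0 : 0 <= c by apply: lb_le_inf; [exact: (proj1 hS)|move=> t [/andP[]]].
have cb : c <= b by apply: ge_inf; first exact: (proj2 hS).
have pos s : 0 <= s < c -> 0 < f s.
  move=> /andP[s0 sc]; rewrite ltNge; apply/negP => fs.
  suff : c <= s by rewrite leNgt sc.
  apply: ge_inf; first exact: (proj2 hS).
  by split => //; rewrite s0 (le_trans (ltW sc) cb).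
have nb (e : R) : e != 0 -> \forall s \near c, `|f c - f s| < `|e|.
  move=> e0; apply: (@cvgr_dist_lt _ _ _ (nbhs c) _ f (f c)).
    exact: fc.
  by rewrite normr_gt0.
have fc_le : f c <= 0.
  rewrite leNgt; apply/negP => fcp.
  have [d /= d0 dH] := (nbhs_ballP _ _).1 (nb (f c) (lt0r_neq0 fcp)).
  have [t St tc] := inf_adherent d0 hS.
  have ct : c <= t by apply: ge_inf; first exact: (proj2 hS).
  have [/andP[t0 tb] ft] := St.
  have : `|f c - f t| < `|f c|.
    apply: dH; rewrite /ball /= ler0_norm; rewrite -/c in tc; lra.
  rewrite (gtr0_norm fcp) ltr_norml; lra.
have cp : 0 < c.
  rewrite lt_neqAle c0 andbT; apply/eqP => E; move: fc_le; rewrite -E; lra.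
have fc_ge : 0 <= f c.
  rewrite leNgt; apply/negP => fcn.
  have [d /= d0 dH] := (nbhs_ballP _ _).1 (nb (f c) (ltr0_neq0 fcn)).
  pose s := Num.max 0 (c - d / 2).
  have sc : s < c by rewrite gt_max cp /=; lra.
  have s0 : 0 <= s by rewrite le_max lexx.
  have cs : c - d / 2 <= s by rewrite le_max lexx orbT.
  have := pos s; rewrite s0 sc => /(_ isT) fs.
  have : `|f c - f s| < `|f c|.
    apply: dH; rewrite /ball /= ger0_norm; lra.
  rewrite (ltr0_norm fcn) ltr_norml; lra.
exists c; split => //; first by rewrite cp.
by apply/le_anti/andP.
Qed.

(** * The time taken along a first-quadrant arc *)

Definition inv_slope {R : realType} (n : nat) : R := (2 * n%:R + 1)^-1.

(** The jump at n^2 of the step function that equals [inv_slope i] on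
    [i^2, (i + 1)^2). *)
Definition slope_jump {R : realType} (n : nat) : R :=
  inv_slope n - (if n is m.+1 then inv_slope m else 0).

Lemma sum_slope_jump {R : realType} (N i : nat) : (i < N)%N ->
  \sum_(n < N) slope_jump n * (n <= i)%:R = inv_slope i :> R.
Proof.
have telescope M : \sum_(n < M.+1) slope_jump n = inv_slope M :> R.
  elim: M => [|M IH]; first by rewrite big_ord1 /slope_jump subr0.
  by rewrite big_ord_recr /= IH /slope_jump addrC subrK.
move=> iN; rewrite -telescope (big_ord_widen_cond N (fun _ => true)) //=.
rewrite [RHS]big_mkcond; apply: eq_bigr => n _ /=.
by rewrite ltnS; case: (n <= i)%N; rewrite ?mulr1 ?mulr0.
Qed.

(** The length of the part of [0, u] on which both s >= n^2 and
    alpha - s >= k^2, that is, where both jumps (n for x, k for y) have been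
    made. *)
Definition arc_term {R : realType} (alpha u : R) (n k : nat) : R :=
  Num.max 0 (Num.min u (alpha - k%:R ^+ 2) - n%:R ^+ 2).

(** The integral over [0, u] of 1 / (P'(x) P'(y)), where P(x) = s and
    P(y) = alpha - s: the time needed to go from x = 0 to P(x) = u. It is
    meant for [alpha < N], when every jump n^2 <= alpha has n <= n^2 < N. *)
Definition arc_clock {R : realType} (N : nat) (alpha u : R) : R :=
  \sum_(n < N) \sum_(k < N) slope_jump n * slope_jump k * arc_term alpha u n k.

Definition quarter_time {R : realType} (N : nat) (alpha : R) : R :=
  arc_clock N alpha alpha.

Lemma arc_clock0 {R : realType} (N : nat) (alpha : R) : arc_clock N alpha 0 = 0.
Proof.
rewrite /arc_clock big1 // => n _; rewrite big1 // => k _.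
have -> : arc_term alpha 0 n k = 0; last by rewrite mulr0.
rewrite /arc_term; apply/max_idPl; rewrite subr_le0 ge_min.
by rewrite sqr_ge0.
Qed.

Lemma cvg_arc_clock {R : realType} (N : nat) (alpha : R) (U : R -> R) :
  continuous U -> continuous (fun t => arc_clock N alpha (U t)).
Proof.
move=> Uc; apply: continuous_big; first exact: add_continuous.
move=> n _; apply: continuous_big; first exact: add_continuous.
move=> k _ t; apply: cvgM; first exact: cvg_cst.
have minc : {for t, continuous ((U : R -> R^o) \min cst (alpha - k%:R ^+ 2))}.
  by apply: continuous_min; [exact: Uc|exact: cvg_cst].
have subc : {for t, continuous
    ((fun s => (U \min cst (alpha - k%:R ^+ 2)) s - n%:R ^+ 2) : R -> R^o)}.
  by apply: cvgB; [exact: minc|exact: cvg_cst].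
exact: (@continuous_max _ _ (cst 0) _ t (@cvg_cst _ _ _ _ _) subc).
Qed.

Lemma is_derive_arc_term {R : realType} (alpha : R) (U : R -> R) (t dU : R)
    (i j n k : nat) :
  is_derive t 1 U dU ->
  i%:R ^+ 2 < U t < i.+1%:R ^+ 2 -> j%:R ^+ 2 < alpha - U t < j.+1%:R ^+ 2 ->
  is_derive t 1 (fun s => arc_term alpha (U s) n k)
    ((n <= i)%:R * (k <= j)%:R * dU).
Proof.
move=> dUt /andP[iU Ui] /andP[jU Uj].
have Uc : {for t, continuous U}.
  by apply: differentiable_continuous; apply/derivable1_diffP; case: dUt.
have sq (a b : nat) : (a <= b)%N -> a%:R ^+ 2 <= b%:R ^+ 2 :> R.
  by move=> ab; rewrite -!natrX ler_nat leq_sqr.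
have [ni|ni] := leqP n i; last first.
  rewrite !mul0r; apply: (near_eq_is_derive (f := cst 0)).
  near=> s; rewrite /arc_term /=; apply/esym/max_idPl; rewrite subr_le0 ge_min.
  apply/orP; left; apply: ltW; apply: lt_le_trans (sq _ _ ni).
  by near: s; apply: (cvgr_lt (U t)).
have [kj|kj] := leqP k j; last first.
  rewrite mulr0 mul0r.
  apply: (near_eq_is_derive (f := cst (Num.max 0 (alpha - k%:R ^+ 2 - n%:R ^+ 2)))).
  near=> s; rewrite /arc_term /=; congr (Num.max 0 (_ - _)); apply/esym/min_idPr.
  rewrite lerBlDl -lerBlDr; apply: le_trans (sq _ _ kj); apply: ltW.
  rewrite ltrBlDl -ltrBlDr.
  by near: s; apply: (cvgr_gt (U t)) => //; rewrite ltrBlDl -ltrBlDr.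
rewrite !mul1r.
apply: (near_eq_is_derive (f := U - cst (n%:R ^+ 2))); last first.
  by apply: is_derive_eq; rewrite subr0.
near=> s; rewrite /arc_term.
have h1 : U s <= alpha - k%:R ^+ 2.
  rewrite lerBrDr -lerBrDl; apply: (le_trans (sq _ _ kj)); apply: ltW.
  rewrite ltrBrDl -ltrBrDr.
  by near: s; apply: (cvgr_lt (U t)) => //; rewrite ltrBrDl -ltrBrDr.
rewrite (min_idPl h1); apply/esym/max_idPr; rewrite subr_ge0.
apply: (le_trans (sq _ _ ni)); apply: ltW.
by near: s; apply: (cvgr_gt (U t)).
Unshelve. all: by end_near.
Qed.

(** The double sum of the jumps made so far factors, so the clock runs at the
    rate 1 / (P'(x) P'(y)) in the cell where floor x = i and floor y = j. *)
Lemma is_derive_arc_clock {R : realType} (N : nat) (alpha : R) (U : R -> R)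
    (t dU : R) (i j : nat) :
  (i < N)%N -> (j < N)%N -> is_derive t 1 U dU ->
  i%:R ^+ 2 < U t < i.+1%:R ^+ 2 -> j%:R ^+ 2 < alpha - U t < j.+1%:R ^+ 2 ->
  is_derive t 1 (fun s => arc_clock N alpha (U s))
    (inv_slope i * inv_slope j * dU).
Proof.
move=> iN jN dUt Ui Uj.
have -> : (fun s => arc_clock N alpha (U s)) =
    \sum_(n < N) \sum_(k < N)
      (slope_jump n * slope_jump k) \*: (fun s => arc_term alpha (U s) n k).
  apply/funext => s; rewrite fct_sumE; apply: eq_bigr => n _.
  by rewrite fct_sumE.
have dT (n k : 'I_N) := @is_derive_arc_term _ alpha U t dU i j n k dUt Ui Uj.
apply: is_derive_eq.
rewrite -(sum_slope_jump N i iN) -(sum_slope_jump N j jN) big_distrl /= big_distrl /=.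
apply: eq_bigr => n _; rewrite big_distrr /= big_distrl /=; apply: eq_bigr => k _.
rewrite [LHS]/GRing.scale /=; ring.
Qed.

(** * One quarter of an orbit *)

Lemma Ham_pos_neq0 {R : realType} (z : R * R) : 0 < Ham z -> z <> (0, 0).
Proof. by move=> + E; rewrite E /Ham /= Pfun0 addr0 ltxx. Qed.

Lemma flow_continuous {R : realType} (phi : R -> R * R -> R * R) (z : R * R) :
  is_flow phi -> z <> (0, 0) ->
  continuous (fun t => (phi t z).1) /\ continuous (fun t => (phi t z).2).
Proof.
move=> [_ _ _ /(_ z) fz] /fz[_ c _ _]; split => t.
  by apply: (cvg_comp (fun t => phi t z) fst (c t)); exact: cvg_fst.
by apply: (cvg_comp (fun t => phi t z) snd (c t)); exact: cvg_snd.
Qed.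

Lemma floor_cell {R : realType} (x : R) (N : nat) :
  0 < x -> x \isn't a Num.int -> Pfun x < N%:R ->
  exists i : nat, [/\ Num.floor x = i, (i < N)%N &
    i%:R ^+ 2 < Pfun x < i.+1%:R ^+ 2].
Proof.
move=> x0 xN PN; have fx0 : 0 <= Num.floor x by rewrite floor_ge0 ltW.
exists `|Num.floor x|%N; have E : Num.floor x = `|Num.floor x|%N by rewrite gez0_abs.
have /andP[h1 h2] := floor_bounds x; rewrite E in h1 h2.
set i := absz _ in E h1 h2 *.
have ix : i%:~R < x.
  by rewrite lt_neqAle h1 andbT; apply: contra xN => /eqP <-; exact: intr_int.
split=> //.
  rewrite -(@ltr_nat R); apply: le_lt_trans PN; apply: le_trans (Pfun_ge x).
  exact: ltW.
have sq (k : nat) : k%:R ^+ 2 = Pfun k%:~R :> R by rewrite Pfun_int.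
by rewrite !sq !Pfun_lt // ?ltW // -[i.+1]addn1 PoszD intrD.
Qed.

(** In the quadrant x increases and y decreases at speed at least 1, so y
    vanishes for the first time at some c > 0. Until then the clock runs at unit
    rate, and it shows [quarter_time] when y = 0; hence c is the quarter time. The
    arc covers the whole quadrant of the level set by the intermediate value
    theorem. *)
Lemma quarter_arc {R : realType} (psi : R -> R * R -> R * R) (X : R) (N : nat) :
  is_flow psi -> 0 < X -> Pfun X < N%:R ->
  let A := quarter_time N (Pfun X) in
  [/\ 0 < A, psi A (0, X) = (X, 0),
      forall t, 0 <= t < A ->
        0 <= (psi t (0, X)).1 /\ 0 < (psi t (0, X)).2,
      forall t, 0 < t < A -> 0 < (psi t (0, X)).1 &
      forall z, 0 <= z.1 -> 0 <= z.2 -> Ham z = Pfun X ->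
        exists t, psi t (0, X) = z].
Proof.
move=> flow X0 PN A.
have p0 : (0, X) <> (0, 0) :> R * R by case=> E; rewrite E ltxx in X0.
have [xc yc] := flow_continuous psi (0, X) flow p0.
have [psi0 _ _ /(_ _ p0)[HamE _ good der]] := flow.
set x := fun t => (psi t (0, X)).1 in xc; set y := fun t => (psi t (0, X)).2 in yc.
have x0 : x 0 = 0 by rewrite /x psi0.
have y0 : y 0 = X by rewrite /y psi0.
have HE t : Pfun (x t) + Pfun (y t) = Pfun X.
  by have := HamE t; rewrite /Ham /= Pfun0 add0r.
have idc (s : R) : (t @[t --> s] --> s) by exact: cvg_id.
(* While [y > 0] both velocity components have modulus at least 1. *)
have xgrow b : 0 <= b -> (forall s, 0 <= s < b -> 0 < y s) -> b <= x b.
  move=> b0 ypos; suff : x 0 - 0 <= x b - b by rewrite x0; lra.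
  apply: (@ndecr_off_isolated _ (fun t => x t - t) _ _ _ b0 _ good).
    by move=> t; apply: cvgB; [exact: xc|exact: idc].
  move=> s /andP[s0 sb] /der[dx _].
  exists (2 * (Num.floor (y s))%:~R).
    by rewrite mulr_ge0 // ler0z floor_ge0 ltW // ypos // sb ltW.
  by apply: is_derive_eq; rewrite addrK.
have ydecay b : 0 <= b -> (forall s, 0 <= s < b -> 0 < y s) -> y b <= X - b.
  move=> b0 ypos; suff : - y 0 - 0 <= - y b - b by rewrite y0; lra.
  apply: (@ndecr_off_isolated _ (fun t => - y t - t) _ _ _ b0 _ good).
    by move=> t; apply: cvgB; [apply: cvgN; exact: yc|exact: idc].
  move=> s /andP[s0 sb] /der[_ dy].
  exists (2 * (Num.floor (x s))%:~R).
    rewrite mulr_ge0 // ler0z floor_ge0 (le_trans (ltW s0)) //.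
    by apply: xgrow => [|u /andP[u0 us]]; [exact: ltW|apply: ypos; lra].
  by apply: is_derive_eq; rewrite opprK addrK.
have [b [b0 yb]] : exists b, 0 <= b /\ y b <= 0.
  apply: contrapT => nex.
  have ypos s : 0 <= s -> 0 < y s.
    by move=> s0; rewrite ltNge; apply/negP => ys; apply: nex; exists s.
  apply: nex; exists X; split; first exact: ltW.
  have := ydecay X (ltW X0) (fun s h => ypos s (proj1 (andP h))); lra.
have [|c [/andP[c0 _] yc0 ypos]] := first_nonpos y b yc _ b0 yb.
  by rewrite y0.
have xpos s : 0 < s <= c -> 0 < x s.
  move=> /andP[s0 sc]; apply: (lt_le_trans s0); apply: xgrow; first exact: ltW.
  by move=> u /andP[u0 us]; apply: ypos; lra.
have xcX : x c = X.
  apply: Pfun_inj; [by apply/ltW/xpos; rewrite c0 /=|exact: ltW|].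
  by rewrite -(HE c) yc0 Pfun0 addr0.
have AE : A = c.
  have Uc : continuous (fun t => Pfun (x t)).
    by move=> t; apply: (cvg_comp x (@Pfun R) (xc t)); exact: Pfun_continuous.
  have := @slope_off_isolated _ (fun t => arc_clock N (Pfun X) (Pfun (x t)))
    _ 1 0 c (ltW c0) (cvg_arc_clock N (Pfun X) _ Uc) good.
  rewrite /= x0 xcX Pfun0 arc_clock0 !subr0 mul1r; apply.
  move=> s /andP[s0 sc] /[dup] -[xN yN] /der[dx dy].
  have xs : 0 < x s by rewrite xpos // s0 ltW.
  have ys : 0 < y s by rewrite ypos // sc ltW.
  have Px0 := Pfun_ge0 (x s); have Py0 := Pfun_ge0 (y s); have := HE s => Es.
  have [|i [ix iN xi]] := floor_cell (x s) N xs xN; first lra.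
  have [|j [jy jN yj]] := floor_cell (y s) N ys yN; first lra.
  have dU : is_derive s 1 (fun t => Pfun (x t))
      ((2 * i%:R + 1) * (2 * j%:R + 1)).
    have := is_derive_Pfun (x s) xN; rewrite ix => dP.
    have := dx; rewrite /= -/(y s) jy => dxs.
    exact: (is_derive1_comp dP dxs).
  have yE : Pfun X - Pfun (x s) = Pfun (y s) by rewrite -(HE s) addrAC subrr add0r.
  have := @is_derive_arc_clock _ N (Pfun X) (fun t => Pfun (x t)) s _ i j iN jN dU xi.
  rewrite yE => /(_ yj) dC; apply: is_derive_eq.
  rewrite /inv_slope; field.
  by rewrite !gt_eqF // ltr_wpDl // mulr_ge0.
rewrite AE; split => //.
- by rewrite [LHS]surjective_pairing -/(x c) -/(y c) xcX yc0.
- move=> t /andP[t0 tc]; split; last by apply: ypos; rewrite t0.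
  move: t0; rewrite le_eqVlt => /orP[/eqP <-|t0]; first by rewrite -/(x 0) x0.
  by apply/ltW/xpos; rewrite t0 ltW.
- by move=> t /andP[t0 tc]; apply: xpos; rewrite t0 ltW.
move=> [u v] /= u0 v0 Huv.
have uX : u <= X.
  rewrite leNgt; apply/negP => /(Pfun_lt X u (ltW X0)).
  by have := Pfun_ge0 v; move: Huv; rewrite /Ham /=; lra.
have [||t] := @IVT _ x 0 c u (ltW c0).
- exact: continuous_subspaceT.
- by rewrite x0 xcX min_l ?max_r ?u0 // ltW.
rewrite in_itv /= => /andP[t0 tc] xt; exists t.
rewrite [LHS]surjective_pairing -/(x t) -/(y t) xt; congr pair.
apply: Pfun_inj => //.
  move: tc; rewrite le_eqVlt => /orP[/eqP ->|tc]; first by rewrite yc0.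
  by apply/ltW/ypos; rewrite t0.
by have := HE t; move: Huv; rewrite xt /Ham /=; lra.
Qed.

(** * The quarter-turn symmetry *)

(** The clockwise turn, which is the sense of the flow: it maps (0, X) to
    (X, 0). *)
Definition quarter_turn {R : realType} (z : R * R) : R * R := (z.2, - z.1).
Definition quarter_turn_back {R : realType} (z : R * R) : R * R := (- z.2, z.1).

Definition turned_flow {R : realType} (phi : R -> R * R -> R * R) (t : R) z :=
  quarter_turn_back (phi t (quarter_turn z)).

Lemma quarter_turnK {R : realType} :
  cancel (@quarter_turn R) quarter_turn_back.
Proof. by case=> a b; rewrite /quarter_turn_back /= opprK. Qed.

Lemma quarter_turn_backK {R : realType} :
  cancel (@quarter_turn_back R) quarter_turn.
Proof. by case=> a b; rewrite /quarter_turn /= opprK. Qed.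

Lemma Ham_quarter_turn {R : realType} (z : R * R) : Ham (quarter_turn z) = Ham z.
Proof. by rewrite /Ham /= Pfun_opp addrC. Qed.

Lemma Ham_quarter_turn_back {R : realType} (z : R * R) :
  Ham (quarter_turn_back z) = Ham z.
Proof. by rewrite /Ham /= Pfun_opp addrC. Qed.

(** P is even, and off the lattice lines the slopes at x and -x are opposite, so
    both the Hamiltonian and the field commute with the quarter turn. The flow is
    not known to be unique, hence the conjugate is a possibly different flow. *)
Lemma is_flow_turned {R : realType} (phi : R -> R * R -> R * R) :
  is_flow phi -> is_flow (turned_flow phi).
Proof.
move=> [phi0 phiD phi00 phiE]; split.
- by move=> z; rewrite /turned_flow phi0 quarter_turnK.
- by move=> s t z; rewrite /turned_flow quarter_turn_backK phiD.
- by move=> t; rewrite /turned_flow /quarter_turn /= oppr0 phi00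
    /quarter_turn_back /= oppr0.
move=> z z0.
have rz0 : quarter_turn z <> (0, 0).
  by move=> E; apply: z0; rewrite -(quarter_turnK z) E /quarter_turn_back /= oppr0.
have flow : is_flow phi by [].
have [c1 c2] := flow_continuous phi _ flow rz0.
have [HE _ good der] := phiE _ rz0.
have offE t : off_lines (turned_flow phi t z) <-> off_lines (phi t (quarter_turn z)).
  by rewrite /off_lines /turned_flow /= rpredN; split=> -[].
split.
- by move=> t; rewrite /turned_flow Ham_quarter_turn_back HE Ham_quarter_turn.
- move=> t; exact: (cvg_pair (cvgN (c2 t)) (c1 t)).
- by move=> t; apply: filterS (good t) => s /offE.
move=> t /offE /[dup] -[xN yN] /der[d1 d2]; split.
  rewrite /= -[_ + 1]opprK; exact: is_deriveN.
by rewrite /= slope_opp // opprK; exact: d1.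
Qed.

(** * Level sets are periodic orbits *)

Lemma flow_comm {R : realType} (phi : R -> R * R -> R * R) (s t : R) z :
  is_flow phi -> phi s (phi t z) = phi t (phi s z).
Proof. by move=> [_ phiD _ _]; rewrite -!phiD addrC. Qed.

Lemma flow_inj {R : realType} (phi : R -> R * R -> R * R) (s : R) :
  is_flow phi -> injective (phi s).
Proof.
move=> [phi0 phiD _ _] z1 z2 E.
by rewrite -(phi0 z1) -(phi0 z2) -(addNr s) !phiD E.
Qed.

Lemma iter_turned_flow {R : realType} (phi : R -> R * R -> R * R) (i : nat) t z :
  iter i quarter_turn (iter i turned_flow phi t z)
    = phi t (iter i quarter_turn z).
Proof.
elim: i z => // i IH z.
by rewrite iterSr iterS {1}/turned_flow quarter_turn_backK IH -iterSr.
Qed.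

Lemma is_flow_iter_turned {R : realType} (phi : R -> R * R -> R * R) (i : nat) :
  is_flow phi -> is_flow (iter i turned_flow phi).
Proof. by move=> flow; elim: i => //= i; exact: is_flow_turned. Qed.

(** An orbit from (0, X) is cut into quarters, each of which is a turned copy of
    the first quarter of a conjugate flow. *)
Lemma flow_quarters {R : realType} (phi : R -> R * R -> R * R) (X : R) (N i : nat) t :
  is_flow phi -> 0 < X -> Pfun X < N%:R ->
  phi (i%:R * quarter_time N (Pfun X) + t) (0, X)
    = iter i quarter_turn (iter i turned_flow phi t (0, X)).
Proof.
move=> flow X0 PN; rewrite iter_turned_flow; have [_ phiD _ _] := flow.
set A := quarter_time _ _; rewrite addrC phiD; congr (phi t _).
elim: i => [|i IH]; first by rewrite mul0r; case: flow.
have flowi := is_flow_iter_turned phi i flow.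
have [_ step _ _ _] := quarter_arc _ X N flowi X0 PN.
rewrite -[i.+1%:R]natr1 mulrDl mul1r addrC phiD IH -iter_turned_flow step.
by rewrite iterSr /quarter_turn /= oppr0.
Qed.

(** The orbit of (0, X) visits the four half-open quadrants in turn, one per
    quarter time, and only the first of them contains (0, X); so it cannot
    close up earlier. *)
Lemma orbit_period {R : realType} (phi : R -> R * R -> R * R) (X : R) (N : nat) :
  is_flow phi -> 0 < X -> Pfun X < N%:R ->
  [/\ 0 < 4 * quarter_time N (Pfun X),
      phi (4 * quarter_time N (Pfun X)) (0, X) = (0, X),
      forall t, 0 < t < 4 * quarter_time N (Pfun X) -> phi t (0, X) <> (0, X) &
      forall z, Ham z = Pfun X -> exists t, phi t (0, X) = z].
Proof.
move=> flow X0 PN.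
have arc i := quarter_arc _ X N (is_flow_iter_turned phi i flow) X0 PN.
have quarter i t := flow_quarters phi X N i t flow X0 PN.
have [A0 _ _ _ _] := arc 0%N.
set A := quarter_time _ _ in arc quarter A0 *.
split.
- lra.
- rewrite -[4 * A]addr0 quarter.
  have [-> _ _ _] := is_flow_iter_turned phi 4 flow.
  by rewrite /= /quarter_turn /= !opprK.
- move=> t /andP[t0 tL] E.
  have split_t (i : nat) (s : R) : t = i%:R * A + s -> 0 <= s < A ->
      exists a b, [/\ (0, X) = iter i quarter_turn (a, b), 0 <= a, 0 < b
        & (i = 0)%N -> 0 < a].
    move=> ts sA; have [_ _ q1 q2 _] := arc i.
    set w := iter i turned_flow phi s (0, X).
    exists w.1, w.2; rewrite -surjective_pairing /w -quarter -ts E.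
    have [h1 h2] := q1 s sA; split=> // i0; apply: q2.
    by case/andP: sA => _ ->; rewrite andbT; move: t0; rewrite ts i0 mul0r add0r.
  have [h1|h1] := ltP t A.
    have [||a [b [E1 _ _ a0]]] := split_t 0%N t; rewrite ?mul0r ?add0r //; first lra.
    by case: E1 => E1; move: (a0 erefl); rewrite -E1 ltxx.
  have [h2|h2] := ltP t (2 * A).
    have [||a [b [[E1 _] _ b0 _]]] := split_t 1%N (t - A); [lra|lra|].
    by rewrite -E1 ltxx in b0.
  have [h3|h3] := ltP t (3 * A).
    have [||a [b [[_ E1] _ b0 _]]] := split_t 2%N (t - 2 * A); [lra|lra|].
    lra.
  have [||a [b [[E1 _] _ b0 _]]] := split_t 3%N (t - 3 * A); [lra|lra|].
  lra.
move=> [u v] Hz.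
have reach (i : nat) (a b : R) : 0 <= a -> 0 <= b ->
    iter i quarter_turn (a, b) = (u, v) -> exists t, phi t (0, X) = (u, v).
  move=> a0 b0 E.
  have Hab : Ham (a, b) = Pfun X.
    rewrite -Hz -E; elim: i {E} => //= i ->; by rewrite Ham_quarter_turn.
  have [_ _ _ _ /(_ (a, b) a0 b0 Hab)[t tE]] := arc i.
  by exists (i%:R * A + t); rewrite quarter tE.
have [u0|u0] := leP 0 u; have [v0|v0] := leP 0 v.
- exact: (reach 0%N u v).
- by apply: (reach 1%N (- v) u) => //; [lra|rewrite /quarter_turn /= opprK].
- by apply: (reach 3%N v (- u)) => //; [lra|rewrite /quarter_turn /= !opprK].
- by apply: (reach 2%N (- u) (- v)); [lra|lra|rewrite /quarter_turn /= !opprK].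
Qed.

Lemma Pfun_surj {R : realType} (alpha : R) : 0 < alpha ->
  exists2 X, 0 < X & Pfun X = alpha.
Proof.
move=> a0.
have [||X] := @IVT _ (@Pfun R) 0 alpha alpha (ltW a0).
- by apply: continuous_subspaceT; exact: Pfun_continuous.
- have := Pfun_ge alpha; rewrite Pfun0 => h.
  by rewrite min_l ?max_r ?(ltW a0) //; apply: le_trans h; exact: ltW.
rewrite in_itv /= => /andP[X0 _] E; exists X => //.
by rewrite lt_neqAle X0 andbT; apply/eqP => X0'; move: a0; rewrite -E -X0' Pfun0 ltxx.
Qed.

(** The flow commutes with itself and is transitive on the level set, so all
    points have the same return times, the multiples of the period of
    (0, X). *)
Lemma periodic_level {R : realType} (phi : R -> R * R -> R * R) (alpha : R) (N : nat) :
  is_flow phi -> 0 < alpha < N%:R ->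
  [/\ 0 < Tperiod phi alpha, Tperiod phi alpha = 4 * quarter_time N alpha &
      forall z, Ham z = alpha -> forall t : R,
        phi t z = z <-> exists n : int, t = n%:~R * Tperiod phi alpha].
Proof.
move=> flow /andP[a0 aN].
have [X X0 PX] := Pfun_surj alpha a0.
have PN : Pfun X < N%:R by rewrite PX.
have [L0 pL minL orbit] := orbit_period phi X N flow X0 PN.
rewrite PX in L0 pL minL orbit.
set L := 4 * _ in L0 pL minL *.
have [phi0 phiD _ _] := flow.
have periodn (n : nat) : phi (n%:R * L) (0, X) = (0, X).
  elim: n => [|n IH]; first by rewrite mul0r phi0.
  by rewrite -natr1 mulrDl mul1r phiD pL IH.
have periodz (n : int) : phi (n%:~R * L) (0, X) = (0, X).
  case: n => n; first exact: periodn.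
  rewrite NegzE intrN; apply: (flow_inj phi (n.+1%:R * L) flow).
  by rewrite -phiD mulNr subrr phi0 periodn.
have perE z t : Ham z = alpha -> phi t z = z <-> exists n : int, t = n%:~R * L.
  move=> /orbit[s <-]; rewrite (flow_comm phi t s _ flow); split; last first.
    by move=> [n ->]; rewrite periodz.
  move=> /(flow_inj phi s flow) tE.
  exists (Num.floor (t / L)); apply/eqP; rewrite -subr_eq0; apply/eqP.
  set n := Num.floor _; set r := t - _.
  have rE : phi r (0, X) = (0, X).
    rewrite /r -mulNr -intrN addrC phiD tE; exact: periodz.
  have /andP[h1 h2] := floor_bounds (t / L).
  have r0 : 0 <= r by rewrite subr_ge0 -ler_pdivlMr.
  have rL : r < L by rewrite ltrBlDr -[X in X + _]mul1r -mulrDl addrC -ltr_pdivrMr.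
  apply: contrapT => /eqP rn0; apply: (minL r) => //.
  by rewrite rL andbT lt_neqAle eq_sym rn0.
have TL : Tperiod phi alpha = L.
  set S := [set t | 0 < t /\ forall z, Ham z = alpha -> phi t z = z].
  have SL : S L by split => // z Hz; apply/perE => //; exists 1; rewrite mul1r.
  have lbS : lbound S L.
    move=> t [t0 tper]; have Hp : Ham (0, X) = alpha by rewrite /Ham /= Pfun0 add0r.
    have [n tn] := (perE _ t Hp).1 (tper _ Hp).
    have n0 : 0 < n by move: t0; rewrite tn pmulr_lgt0 // ltr0z.
    rewrite tn; apply: ler_peMl; first exact: ltW.
    rewrite ler1z; lia.
  apply/le_anti/andP; split; first by apply: ge_inf => //; exists L.
  by apply: lb_le_inf => //; exists L.
by rewrite TL; split => // z Hz t; exact: perE.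
Qed.

(** * The derivative of the period *)

(** No sum n^2 + k^2 lies strictly between consecutive critical numbers, so each
    summand is either affine or zero on the whole interval. *)
Lemma quarter_time_affine {R : realType} (N e e' : nat) : next_crit e e' ->
  exists d b : R, forall alpha, e%:R < alpha < e'%:R ->
    quarter_time N alpha = d * alpha + b.
Proof.
move=> [_ _ gap].
pose on (n k : nat) : R := slope_jump n * slope_jump k * (n ^ 2 + k ^ 2 <= e)%N%:R.
exists (\sum_(n < N) \sum_(k < N) on n k),
  (\sum_(n < N) \sum_(k < N) - (on n k * (n ^ 2 + k ^ 2)%:R)) => alpha /andP[ea ae].
rewrite /quarter_time /arc_clock big_distrl -big_split /=; apply: eq_bigr => n _.
rewrite big_distrl -big_split /=; apply: eq_bigr => k _.
have k2 : 0 <= (k%:R : R) ^+ 2 by exact: sqr_ge0.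
have -> : arc_term alpha alpha n k = (n ^ 2 + k ^ 2 <= e)%N%:R * (alpha - (n ^ 2 + k ^ 2)%:R).
  rewrite /arc_term (min_idPr _); last by rewrite lerBlDr lerDl.
  rewrite natrD !natrX.
  have [le_e|gt_e] := leqP.
    rewrite mul1r (max_idPr _); first by ring.
    have : (n ^ 2 + k ^ 2)%:R <= e%:R :> R by rewrite ler_nat.
    rewrite natrD !natrX; lra.
  rewrite mul0r; apply/max_idPl.
  have : (e' <= n ^ 2 + k ^ 2)%N.
    apply: gap => //; exists n, k; by rewrite PoszD !expr2 -!PoszM !mulnn.
  rewrite -(@ler_nat R) natrD !natrX; lra.
rewrite /on; ring.
Qed.

Lemma crit_itvP {R : realType} (e : nat) (a b : R) :
  crit_itv e a -> crit_itv e b ->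
  exists e', [/\ next_crit e e', e%:R < a < e'%:R & e%:R < b < e'%:R].
Proof.
move=> [e1 n1 a1] [e2 n2 b2]; exists e1; split => //.
suff -> : e1 = e2 by [].
by case: n1 => c1 l1 m1; case: n2 => c2 l2 m2; apply/eqP; rewrite eqn_leq m1 // m2.
Qed.

(** This form of the constancy of the derivative also identifies [dTperiod],
    which is chosen as some common derivative on the interval. *)
Lemma Tperiod_affine {R : realType} (phi : R -> R * R -> R * R) (e : nat) (a b : R) :
  is_flow phi -> crit_itv e a -> crit_itv e b ->
  Tperiod phi a - Tperiod phi b = dTperiod phi e * (a - b).
Proof.
move=> flow ea eb; have [e' [nxt ia ib]] := crit_itvP e a b ea eb.
have [d [c dE]] := @quarter_time_affine R e' e e' nxt.
have e0 : 0 <= e%:R :> R by [].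
have TE x : e%:R < x < e'%:R -> Tperiod phi x = 4 * d * x + 4 * c.
  move=> /[dup] ix /andP[x1 x2].
  have x0 : 0 < x < e'%:R by rewrite x2 (le_lt_trans e0).
  have [_ -> _] := periodic_level phi x e' flow x0.
  by rewrite dE //; ring.
have dT x : crit_itv e x -> is_derive x 1 (Tperiod phi) (4 * d).
  move=> /(crit_itvP e x a) /(_ ea)[e2 [nxt2 ix ia2]].
  have {}ix : e%:R < x < e'%:R.
    suff -> : e' = e2 by [].
    by case: nxt => c1 l1 m1; case: nxt2 => c2 l2 m2;
      apply/eqP; rewrite eqn_leq m1 // m2.
  have lin : is_derive x (1 : R) (fun y : R => 4 * d * y + 4 * c) (4 * d).
    by apply: is_derive_eq; rewrite addr0 [LHS]mulr1.
  apply: near_eq_is_derive lin; case/andP: ix => x1 x2.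
  near=> y; apply/esym/TE/andP; split; near: y; [exact: lt_nbhsr|exact: lt_nbhsl].
have dTE : dTperiod phi e = 4 * d.
  have [_ <-] := dT a ea.
  have : exists d : R, forall x, crit_itv e x -> is_derive x 1 (Tperiod phi) d.
    by exists (4 * d).
  by move=> /getPex /(_ a ea)[_ ->].
by rewrite dTE !TE //; ring.
Unshelve. all: by end_near.
Qed.

(** * The section at a regular level *)

(** At a regular level the field agrees with the field of the diagonal box on the
    whole section arc; its two components determine both floors. *)
Lemma regular_range_floor {R : realType} (phi : R -> R * R -> R * R) (e : nat)
    (lambda : R) z :
  0 < lambda -> Xsection phi lambda z -> regular_range phi e lambda (Ham z) ->
  Num.floor z.1 = diag_box R e /\ Num.floor z.2 = diag_box R e.
Proof.
move=> l0 Xz [J [_ _ /(_ z Xz) reg]] /reg[_ /addrI/(scalerI (lt0r_neq0 l0))].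
rewrite /wfield /wbox => -[+ /oppr_inj].
have two0 : (2 : R) != 0 by rewrite pnatr_eq0.
by move=> /addIr/(mulfI two0)/intr_inj-> /addIr/(mulfI two0)/intr_inj->.
Qed.

(** In one box the velocity is constant, so the section arc is a segment. Only
    times closer to 0 than [lambda * theta] enter, hence the value at the end
    follows by continuity. *)
Lemma straight_section {R : realType} (phi : R -> R * R -> R * R) (m : int)
    (lambda x : R) :
  is_flow phi -> 0 < lambda -> 0 < Ham (x, x) ->
  (forall theta, - (1 / 2) <= theta < 1 / 2 ->
    Num.floor (phi (lambda * theta) (x, x)).1 = m /\
    Num.floor (phi (lambda * theta) (x, x)).2 = m) ->
  forall theta, - (1 / 2) <= theta < 1 / 2 ->
    phi (lambda * theta) (x, x)
      = (x + lambda * theta * (2 * m%:~R + 1), x - lambda * theta * (2 * m%:~R + 1)).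
Proof.
move=> flow l0 Hx box theta th.
have xn0 := Ham_pos_neq0 (x, x) Hx.
have [c1 c2] := flow_continuous phi (x, x) flow xn0.
have [phi0 _ _ /(_ _ xn0)[_ _ good der]] := flow.
have inbox s : `|s| < `|lambda * theta| ->
    Num.floor (phi s (x, x)).1 = m /\ Num.floor (phi s (x, x)).2 = m.
  move=> sth; have -> : s = lambda * (s / lambda) by rewrite mulrC divfK ?gt_eqF.
  apply: box; set r := s / lambda.
  have : `|r| < `|theta|.
    by rewrite /r normrM normfV (gtr0_norm l0) ltr_pdivrMr // mulrC
      -{1}(gtr0_norm l0) -normrM.
  have tn : `|theta| <= 1 / 2 by rewrite ler_norml; case/andP: th => h1 h2; lra.
  move=> /lt_le_trans /(_ tn); rewrite ltr_norml => /andP[h1 h2]; lra.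
have slope a b : a <= b -> `|a| <= `|lambda * theta| -> `|b| <= `|lambda * theta| ->
   (a = 0 \/ b = 0) ->
   (phi b (x, x)).1 - (phi a (x, x)).1 = (2 * m%:~R + 1) * (b - a) /\
   (phi b (x, x)).2 - (phi a (x, x)).2 = - (2 * m%:~R + 1) * (b - a).
  move=> ab al bl ab0.
  have inb s : a < s < b -> `|s| < `|lambda * theta|.
    move=> /andP[as_ sb]; case: ab0 => E; rewrite E in as_ sb al bl *.
      by rewrite gtr0_norm //; apply: lt_le_trans sb (le_trans (ler_norm _) bl).
    rewrite ltr0_norm //; apply: lt_le_trans al; rewrite ltr0_norm ?ltrN2 //; lra.
  split.
    apply: (slope_off_isolated (fun s => (phi s (x, x)).1) _ _ _ _ ab c1 good).
    by move=> s /inb/inbox[_ f2] /der[d1 _]; rewrite /= f2 in d1.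
  apply: (slope_off_isolated (fun s => (phi s (x, x)).2) _ _ _ _ ab c2 good).
  by move=> s /inb/inbox[f1 _] /der[_ d2]; rewrite /= f1 in d2.
rewrite [LHS]surjective_pairing.
have n0 : `|0 : R| <= `|lambda * theta| by rewrite normr0.
have [t0|t0] := leP 0 (lambda * theta).
  have [s1 s2] := slope _ _ t0 n0 (lexx _) (or_introl erefl).
  rewrite !phi0 /= in s1 s2; congr pair; lra.
have [s1 s2] := slope _ _ (ltW t0) (lexx _) n0 (or_intror erefl).
rewrite !phi0 /= in s1 s2; congr pair; lra.
Qed.

Lemma Xe_straight {R : realType} (phi : R -> R * R -> R * R) (e : nat) (lambda x : R) :
  is_flow phi -> 0 < lambda -> 0 <= x -> regular_range phi e lambda (Ham (x, x)) ->
  [/\ crit_itv e (Ham (x, x)), 0 < Ham (x, x),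
      Num.floor x = diag_box R e &
      forall theta, - (1 / 2) <= theta < 1 / 2 ->
      phi (lambda * theta) (x, x)
      = (x + lambda * theta * (2 * (diag_box R e)%:~R + 1),
         x - lambda * theta * (2 * (diag_box R e)%:~R + 1))].
Proof.
move=> flow l0 x0 reg.
have cx : crit_itv e (Ham (x, x)) by case: reg => J [_ JI _]; exact: JI.
have Hx : 0 < Ham (x, x).
  by case: cx => e' _ /andP[h _]; apply: le_lt_trans h.
have [phi0 _ _ /(_ _ (Ham_pos_neq0 _ Hx))[HE _ _ _]] := flow.
have box theta : - (1 / 2) <= theta < 1 / 2 ->
    Num.floor (phi (lambda * theta) (x, x)).1 = diag_box R e /\
    Num.floor (phi (lambda * theta) (x, x)).2 = diag_box R e.
  move=> th; apply: (@regular_range_floor _ phi e lambda) => //; last by rewrite HE.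
  by exists x, theta.
split => //; last exact: straight_section.
have th0 : - (1 / 2) <= (0 : R) < 1 / 2 by apply/andP; split; lra.
by have [+ _] := box 0 th0; rewrite mulr0 phi0.
Qed.

Lemma diag_box_ge0 (R : realType) (e : nat) : 0 <= (diag_box R e)%:~R :> R.
Proof. by rewrite ler0z floor_ge0 sqrtr_ge0. Qed.

(** A shorter period would make two points of the half-open section segment
    coincide. *)
Lemma le_lambda_Tperiod {R : realType} (phi : R -> R * R -> R * R) (e : nat)
    (lambda x : R) :
  is_flow phi -> 0 < lambda -> 0 <= x -> regular_range phi e lambda (Ham (x, x)) ->
  lambda <= Tperiod phi (Ham (x, x)).
Proof.
move=> flow l0 x0 reg.
have [[e' _ /andP[_ He']] Hx _ straight] := Xe_straight phi e lambda x flow l0 x0 reg.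
have Hx' : 0 < Ham (x, x) < e'%:R by rewrite Hx.
have [T0 _ /(_ _ erefl (Tperiod phi (Ham (x, x))))[_ per]] :=
  periodic_level phi _ e' flow Hx'.
have [_ phiD _ _] := flow.
set T := Tperiod _ _ in T0 per *; rewrite leNgt; apply/negP => Tl.
have Tx : phi T (x, x) = (x, x) by apply: per; exists 1; rewrite mul1r.
have r0 : 0 < T / lambda by rewrite divr_gt0.
have r1 : T / lambda < 1 by rewrite ltr_pdivrMr // mul1r.
have := straight (- (1 / 2) + T / lambda).
have -> : lambda * (- (1 / 2) + T / lambda) = lambda * - (1 / 2) + T.
  by field; rewrite gt_eqF.
rewrite phiD Tx straight; last by apply/andP; split; lra.
have m0 := diag_box_ge0 R e.
have r_range : - (1 / 2) <= - (1 / 2) + T / lambda < 1 / 2 by apply/andP; split; lra.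
move=> /(_ r_range)[E _].
have : 0 < T * (2 * (diag_box R e)%:~R + 1) by apply: mulr_gt0 => //; lra.
lra.
Qed.

(** A level set meets the half-diagonal x >= 0 once, so the only section arc at
    this level is the one around (x, x), and the times at which it is met are
    known modulo the period. *)
Lemma Xe_orbit {R : realType} (phi : R -> R * R -> R * R) (e : nat) (lambda x s : R) :
  is_flow phi -> 0 < lambda -> 0 <= x -> regular_range phi e lambda (Ham (x, x)) ->
  Xe phi e lambda (phi s (x, x)) <->
  exists theta (n : int), - (1 / 2) <= theta < 1 / 2 /\
     s = lambda * theta + n%:~R * Tperiod phi (Ham (x, x)).
Proof.
move=> flow l0 x0 reg.
have [[e' _ /andP[_ He']] Hx _ _] := Xe_straight phi e lambda x flow l0 x0 reg.
have Hx' : 0 < Ham (x, x) < e'%:R by rewrite Hx.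
have [T0 _ per] := periodic_level phi _ e' flow Hx'.
have [phi0 phiD phi00 phiE] := flow.
have HE t := (let: And4 H _ _ _ := phiE _ (Ham_pos_neq0 _ Hx) in H t).
split; last first.
  move=> [theta [n [th ->]]]; rewrite phiD.
  have -> : phi (n%:~R * Tperiod phi (Ham (x, x))) (x, x) = (x, x).
    by apply/per => //; exists n.
  by split; [exists x, theta|rewrite HE].
move=> [[x' [theta [x'0 th E]]] _].
have Hx'E : Ham (x', x') = Ham (x, x).
  rewrite -(HE s) E.
  have nz : (x', x') <> (0, 0).
    move=> z0; move: (HE s); rewrite E z0 phi00 {1}/Ham /= Pfun0 addr0 => h.
    by rewrite -h ltxx in Hx.
  by have [-> _ _ _] := phiE _ nz.
have xx' : x' = x by apply: Pfun_inj => //; move: Hx'E; rewrite /Ham /=; lra.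
rewrite xx' in E; exists theta.
have /per[//|n nE] : phi (s - lambda * theta) (x, x) = (x, x).
  by apply: (flow_inj phi (lambda * theta) flow); rewrite -phiD addrC subrK.
by exists n; split => //; rewrite -nE addrC subrK.
Qed.

(** * The first return *)

(** Time is measured in units of lambda, and [tau] is the period. The iterate k
    has a representative near a point q quarter periods away, with q = k modulo
    4. The value q = 1 gives the return with k = 4j + 1. A value q <= 0 would
    force k <= 0; a value q > 1 gives, since tau >= 1, an index k > (4j + 1) +
    (q - 1) - 4, and by the congruence modulo 4 it is not before 4j + 1. *)
Lemma first_return_rotation {R : realType} (tau theta : R) :
  1 <= tau -> - (1 / 2) <= theta < 1 / 2 ->
  let returns (k : nat) (theta' : R) (n : int) :=
    - (1 / 2) <= theta' < 1 / 2 /\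
    theta + k%:R * ((1 - tau) / 4) = theta' + n%:~R * tau in
  exists (k : nat) (theta' : R) (j : int),
    [/\ (0 < k)%N, returns k theta' (- j),
        forall (k' : nat) theta'' n, (0 < k' < k)%N -> ~ returns k' theta'' n &
        theta' = theta + (1 - tau) / 4 + j%:~R].
Proof.
move=> tau1 /andP[th1 th2] returns.
pose f := Num.floor (theta + (1 - tau) / 4 + 1 / 2).
have /andP[f1 f2] := floor_bounds (theta + (1 - tau) / 4 + 1 / 2).
rewrite -/f in f1 f2.
have f0 : f <= 0.
  by rewrite -ltzD1 add0r -(@ltrz1 R); lra.
pose j : nat := `|f|%N.
have fj : f = - j%:Z by rewrite /j; lia.
rewrite fj intrN in f1 f2.
exists (4 * j + 1)%N, (theta + (1 - tau) / 4 + j%:R), j; split => //.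
- by rewrite addn1.
- split; first by apply/andP; split; lra.
  by rewrite natrD natrM intrN; field.
move=> k th' n /andP[k0 kj] [/andP[t1 t2] E].
(* The return equation reads theta + k/4 = theta'' + q tau/4, so [q] is the
   number of quarter periods that the elapsed time k/4 makes up. *)
pose q : int := k%:Z + 4 * n.
have qE : q%:~R = k%:R + 4 * n%:~R :> R by rewrite intrD intrM.
have E' : k%:R = 4 * (th' - theta) + q%:~R * tau by rewrite qE; lra.
have [q1|q1] := lerP 1 q.
  have q1R : 1 <= q%:~R :> R by rewrite ler1z.
  have : q%:~R - 1 <= (q%:~R - 1) * tau by apply: ler_peMr => //; lra.
  have : (q - 5 < k%:Z - (4 * j%:Z + 1)) -> False by lia.
  rewrite -(@ltr_int R) !(intrD, intrN, intrM) => H h; apply: H.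
  rewrite /=; lra.
have q0R : q%:~R <= 0 :> R by rewrite lerz0; lia.
have : q%:~R * tau <= q%:~R by apply: ler_neMr.
have : (k%:Z < q + 4) -> False by lia.
rewrite -(@ltr_int R) !(intrD, intrN, intrM) => H h; apply: H.
rewrite /=; lra.
Qed.

Lemma iter_Fmap {R : realType} (phi : R -> R * R -> R * R) (lambda : R) (k : nat) z :
  is_flow phi -> 0 < Ham z ->
  iter k (Fmap phi lambda) z = phi (k%:R * ((lambda - Tperiod phi (Ham z)) / 4)) z.
Proof.
move=> flow Hz; have [phi0 phiD _ /(_ _ (Ham_pos_neq0 _ Hz))[HE _ _ _]] := flow.
elim: k => [|k IH]; first by rewrite mul0r phi0.
rewrite iterS IH /Fmap HE -phiD -[k.+1%:R]natr1; congr (phi _ _).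
by rewrite [RHS]mulrDl mul1r addrC.
Qed.

(** The levels are invariant, so the first return to the whole of [Xe] is the
    first return to the section arc at the level of (x, x). *)
Lemma return_map {R : realType} (phi : R -> R * R -> R * R) (e : nat)
    (lambda x theta : R) :
  is_flow phi -> 0 < lambda -> 0 <= x -> regular_range phi e lambda (Ham (x, x)) ->
  - (1 / 2) <= theta < 1 / 2 ->
  exists (k : nat) (theta' : R) (j : int),
  [/\ first_return phi e lambda (phi (lambda * theta) (x, x)) k,
      iter k (Fmap phi lambda) (phi (lambda * theta) (x, x))
        = phi (lambda * theta') (x, x),
      - (1 / 2) <= theta' < 1 / 2 &
      theta' = theta + (1 - Tperiod phi (Ham (x, x)) / lambda) / 4 + j%:~R].
Proof.
move=> flow l0 x0 reg th.
have lT := le_lambda_Tperiod phi e lambda x flow l0 x0 reg.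
have [[e' _ /andP[_ He']] Hx _ _] := Xe_straight phi e lambda x flow l0 x0 reg.
have Hx' : 0 < Ham (x, x) < e'%:R by rewrite Hx.
have [T0 _ /(_ _ erefl) per] := periodic_level phi _ e' flow Hx'.
have [_ phiD _ /(_ _ (Ham_pos_neq0 _ Hx))[HE _ _ _]] := flow.
have orbit k : iter k (Fmap phi lambda) (phi (lambda * theta) (x, x))
    = phi (lambda * theta + k%:R * ((lambda - Tperiod phi (Ham (x, x))) / 4)) (x, x).
  by rewrite iter_Fmap ?HE // -phiD addrC.
set T := Tperiod _ _ in lT T0 per orbit *.
have tau1 : 1 <= T / lambda by rewrite ler_pdivlMr // mul1r.
have l0' : lambda != 0 by rewrite gt_eqF.
have [k [th' [j [k0 [th'b E] min_k th'E]]]] := first_return_rotation _ _ tau1 th.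
have scale (k1 : nat) (t1 : R) (n : int) :
    theta + k1%:R * ((1 - T / lambda) / 4) = t1 + n%:~R * (T / lambda) <->
    lambda * theta + k1%:R * ((lambda - T) / 4) = lambda * t1 + n%:~R * T.
  split=> h.
    have := congr1 ( *%R lambda) h; rewrite !mulrDr.
    have -> : lambda * (k1%:R * ((1 - T / lambda) / 4)) = k1%:R * ((lambda - T) / 4).
      by field.
    by have -> : lambda * (n%:~R * (T / lambda)) = n%:~R * T by field.
  apply: (mulfI l0'); rewrite !mulrDr.
  have -> : lambda * (k1%:R * ((1 - T / lambda) / 4)) = k1%:R * ((lambda - T) / 4).
    by field.
  by have -> : lambda * (n%:~R * (T / lambda)) = n%:~R * T by field.
move/scale in E.
exists k, th', j; split => //.
  split => //.
    by rewrite orbit; apply/Xe_orbit => //; exists th', (- j).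
  move=> i ik; rewrite orbit => /Xe_orbit[] // t1 [n [t1b /scale ret]].
  exact: (min_k i t1 n ik).
rewrite orbit E phiD; congr (phi _ _); apply/per; by exists (- j).
Qed.

Lemma first_return_unique {R : realType} (phi : R -> R * R -> R * R) (e : nat)
    (lambda : R) z (k1 k2 : nat) :
  first_return phi e lambda z k1 -> first_return phi e lambda z k2 -> k1 = k2.
Proof.
move=> [p1 X1 m1] [p2 X2 m2]; case: (ltngtP k1 k2) => // lt12.
  by case: (m2 k1); rewrite ?p1.
by case: (m1 k2); rewrite ?p2.
Qed.

(** * The cylinder coordinates *)

Lemma toS1_eq {R : realType} (a b : R) (n : int) : a = b + n%:~R -> toS1 a = toS1 b.
Proof.
move=> ->; rewrite /toS1; set pa := toS1_subproof _; set pb := toS1_subproof b.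
move: pa pb; set u := _ - _; set v := _ - _.
have -> : u = v.
  by rewrite /u /v [b + _ + _]addrAC floorDrz ?intr_int // intrKfloor intrD; ring.
by move=> pa pb; rewrite (bool_irrelevance pa pb).
Qed.

(** On a straight section the cylinder angle is the time offset from the
    diagonal, and the height depends on the level only. *)
Lemma eta_coord_section {R : realType} (e : nat) (lambda x0 x theta : R) :
  lambda != 0 ->
  let c := 2 * (diag_box R e)%:~R + 1 in
  eta_coord e lambda x0 (x + lambda * theta * c, x - lambda * theta * c)
    = (toS1 theta, (x - x0) / (lambda * c)).
Proof.
move=> l0 c; have m0 := diag_box_ge0 R e.
have c0 : 2 * (diag_box R e)%:~R + 1 != 0 :> R by rewrite gt_eqF //; lra.
rewrite /eta_coord /c /=; congr (toS1 _, _); field; exact/andP.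
Qed.

Lemma sval_toS1 {R : realType} (theta : R) : - (1 / 2) <= theta < 1 / 2 ->
  sval (toS1 theta) = theta.
Proof.
move=> /andP[h1 h2] /=.
have -> : Num.floor (theta + 1 / 2) = 0.
  by apply: floor_def; rewrite add0r; apply/andP; split; lra.
by rewrite subr0.
Qed.

(** * The return map as a twist *)

Theorem theorem3 (R : realType) (phi : R -> R * R -> R * R)
    (flow_phi : is_flow phi) (e : nat) (crit_e : crit e) :
  exists2 lambda0 : R, 0 < lambda0 &
    forall lambda : R, 0 < lambda < lambda0 ->
    forall x0 : R, Xe phi e lambda (x0, x0) ->
      return_fixed phi e lambda (x0, x0) ->
    forall z : R * R, Xe phi e lambda z ->
    exists2 t : nat, first_return phi e lambda z t &
      eta_coord e lambda x0 (iter t (Fmap phi lambda) z)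
        = twist (shear phi e) (eta_coord e lambda x0 z).
Proof.
(* [lambda <= T] follows from regularity, whatever lambda is, so the threshold
   can be any positive number. *)
exists 1 => // lambda /andP[l0 _] x0 Xx0 [k0 ret0 fix0] z Xz.
have ln0 : lambda != 0 by rewrite gt_eqF.
have m0 := diag_box_ge0 R e.
have c0 : 2 * (diag_box R e)%:~R + 1 != 0 :> R by rewrite gt_eqF //; lra.
have [phi0 _ _ phiE] := flow_phi.
have section w : Xe phi e lambda w -> exists x theta,
    [/\ 0 <= x, - (1 / 2) <= theta < 1 / 2, w = phi (lambda * theta) (x, x) &
        regular_range phi e lambda (Ham (x, x))].
  move=> [[x [theta [xp th ->]]] reg]; exists x, theta; split => //.
  have [xx0|xx0] := eqVneq (x, x) ((0, 0) : R * R).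
    by move: reg; rewrite xx0; have [_ _ -> _] := flow_phi.
  by have [HE _ _ _] := phiE _ (elimN eqP xx0); rewrite HE in reg.
have [x [theta [xp th zE reg]]] := section z Xz.
have [cx Hx fx straight] := Xe_straight phi e lambda x flow_phi l0 xp reg.
have [x1 [theta1 [x1p th1 x0E reg1]]] := section _ Xx0.
have [cx1 Hx1 fx1 straight1] := Xe_straight phi e lambda x1 flow_phi l0 x1p reg1.
have zero : - (1 / 2) <= (0 : R) < 1 / 2 by apply/andP; split; lra.
set c : R := 2 * (diag_box R e)%:~R + 1 in c0 straight straight1.
have [th10 x10] : theta1 = 0 /\ x1 = x0.
  move: x0E; rewrite straight1 // => -[E1 E2].
  have : lambda * theta1 * c = 0 by lra.
  move=> /eqP; rewrite !mulf_eq0 (negPf ln0) (negPf c0) orbF /= => /eqP t10.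
  by split => //; move: E1; rewrite t10; lra.
subst x1 theta1.
have [k1 [th1' [j1 [ret1 it1 th1'b th1'E]]]] :=
  return_map phi e lambda x0 0 flow_phi l0 x1p reg1 zero.
rewrite -x0E in ret1 it1.
have kk := first_return_unique _ _ _ _ _ _ ret0 ret1.
have th1'0 : th1' = 0.
  move: fix0; rewrite kk it1 straight1 // => -[E1 _].
  have : lambda * th1' * c = 0 by lra.
  by move=> /eqP; rewrite !mulf_eq0 (negPf ln0) (negPf c0) orbF /= => /eqP.
have [k [th' [j [ret it th'b th'E]]]] :=
  return_map phi e lambda x theta flow_phi l0 xp reg th.
rewrite -zE in ret it; exists k => //.
rewrite it zE !straight // !eta_coord_section // /twist sval_toS1 //.
congr pair; apply: (toS1_eq _ _ (j - j1)).
have TT := Tperiod_affine phi e _ _ flow_phi cx cx1.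
have HH : Ham (x, x) - Ham (x0, x0) = 2 * c * (x - x0).
  by rewrite /Ham /= !PfunE fx fx1 /c; ring.
rewrite HH in TT.
have T0 : Tperiod phi (Ham (x0, x0)) = (1 + 4 * j1%:~R) * lambda.
  have : Tperiod phi (Ham (x0, x0)) / lambda = 1 + 4 * j1%:~R.
    by move: th1'E; rewrite th1'0; lra.
  by move=> <-; rewrite divfK.
have Tx : Tperiod phi (Ham (x, x))
    = (1 + 4 * j1%:~R) * lambda + dTperiod phi e * (2 * c * (x - x0)).
  by rewrite -T0 -TT; ring.
rewrite th'E Tx /shear -/c intrB /=; field.
exact/andP.
Qed.
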